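(* Let $\tau$ be a generic Euclidean triangle, with triangle group $G_\tau=\langle r_1,r_2,r_3\rangle$ (see context). Then $G_\tau$ admits the presentation $$\langle x_1,x_2,x_3 \mid x_1^2,\ x_2^2,\ x_3^2,\ [\,w,\ g_{n,m}^{-1}\,w\,g_{n,m}\,]\ \text{ for } n,m\in\mathbb{Z},\ (n,m)\neq(0,0)\rangle,$$ where $w=(x_1x_2x_3)^2$ and $g_{n,m}=(x_1x_2)^n(x_1x_3)^m$, with the generator $x_i$ corresponding to $r_i$ for $i=1,2,3$.
   Context: A Euclidean triangle $\tau=A_1A_2A_3$ has edges $e_i=A_jA_k$ of length $\ell_i>0$, $\{i,j,k\}=\{1,2,3\}$. It is generic if for some real $k>0$ the numbers $k\ell_1,k\ell_2,k\ell_3$ are algebraically independent over $\mathbb{Q}$. Let $r_i$ be the reflection of the plane across the line containing $e_i$ and $G_\tau=\langle r_1,r_2,r_3\rangle\subset \mathrm{E}(2)$. Isometries act on the right and products are composed left to right: $(x)gh=((x)g)h$. Commutators are $[a,b]=aba^{-1}b^{-1}$. *)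

(* Defs.v *)
From mathcomp Require Import all_boot all_algebra.
From mathcomp Require Import reals.
From mathcomp Require Import mpoly.

Set Implicit Arguments.
Unset Strict Implicit.
Unset Printing Implicit Defensive.

Import GRing.Theory Num.Theory.
Local Open Scope ring_scope.

Record group := Group {
  gcar :> Type;
  gmul : gcar -> gcar -> gcar;
  ginv : gcar -> gcar;
  gone : gcar;
  gmulA : forall x y z, gmul x (gmul y z) = gmul (gmul x y) z;
  gmul1g : forall x, gmul gone x = x;
  gmulg1 : forall x, gmul x gone = x;
  gmulVg : forall x, gmul (ginv x) x = gone;
  gmulgV : forall x, gmul x (ginv x) = gone
}.

(* Words in the free group on x_1, x_2, x_3 (indexed by 'I_3:           *)
(* ord 0 = x_1, 1 = x_2, 2 = x_3).  A letter (i, b) is x_i if b = false *)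
(* and x_i^{-1} if b = true.  A word is the product of its letters, read *)
(* left to right.                                                        *)
Definition letter := ('I_3 * bool)%type.
Definition word := seq letter.

Definition xgen (i : 'I_3) : word := [:: (i, false)].
Definition winv (u : word) : word := rev [seq (l.1, ~~ l.2) | l <- u].
Definition wpow (u : word) (n : int) : word :=
  match n with
  | Posz k => flatten (nseq k u)
  | Negz k => flatten (nseq k.+1 (winv u))
  end.
Definition wcomm (a b : word) : word := a ++ b ++ winv a ++ winv b.

Definition x1 : 'I_3 := @Ordinal 3 0 isT.
Definition x2 : 'I_3 := @Ordinal 3 1 isT.
Definition x3 : 'I_3 := @Ordinal 3 2 isT.

Definition w_word : word := wpow (xgen x1 ++ xgen x2 ++ xgen x3) 2.
Definition g_word (n m : int) : word :=
  wpow (xgen x1 ++ xgen x2) n ++ wpow (xgen x1 ++ xgen x3) m.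

Definition is_relator (u : word) : Prop :=
  (exists i : 'I_3, u = xgen i ++ xgen i) \/
  (exists n m : int, (n, m) <> (0, 0) /\
     u = wcomm w_word (winv (g_word n m) ++ w_word ++ g_word n m)).

Definition eval_letter (H : group) (h : 'I_3 -> H) (l : letter) : H :=
  if l.2 then ginv (h l.1) else h l.1.
Definition eval_word (H : group) (h : 'I_3 -> H) (u : word) : H :=
  foldr (fun l acc => gmul (eval_letter h l) acc) (gone H) u.

(* Isometries of the Euclidean plane R^2 (points are row vectors).      *)
(* An isometry is represented by a pair (A, b), A orthogonal, acting on *)
(* the right: x |-> x *m A + b.  Products are composed left to right:   *)
(* (x)gh = ((x)g)h.                                                      *)
Section Plane.
Variable R : realType.

Definition point := 'rV[R]_2.
Definition isom := ('M[R]_2 * 'rV[R]_2)%type.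

Definition isom_act (g : isom) (x : point) : point := x *m g.1 + g.2.
Definition isom_one : isom := (1%:M, 0).
Definition isom_mul (g h : isom) : isom := (g.1 *m h.1, g.2 *m h.1 + h.2).
(* inverse of an isometry (A orthogonal, so A^-1 = A^T) *)
Definition isom_inv (g : isom) : isom := (g.1^T, - (g.2 *m g.1^T)).

Definition dot (u v : point) : R := (u *m v^T) 0 0.
Definition dist (P Q : point) : R := Num.sqrt (dot (P - Q) (P - Q)).

(* Reflection across the line through P and Q (P != Q):
   x |-> P + (x - P) M,  M = (2 / |v|^2) v^T v - 1,  v = Q - P. *)
Definition refl_line (P Q : point) : isom :=
  let v := Q - P in
  let M := (2 / dot v v) *: (v^T *m v) - 1%:M in
  (M, P - P *m M).

Definition eval_isom (g : 'I_3 -> isom) (u : word) : isom :=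
  foldr (fun l acc => isom_mul (if l.2 then isom_inv (g l.1) else g l.1) acc)
        isom_one u.

Definition tri_nondegenerate (A : 'I_3 -> point) : Prop :=
  let u := A x2 - A x1 in let v := A x3 - A x1 in
  u 0 0 * v 0 1 - u 0 1 * v 0 0 != 0.

(* Edge e_i = A_j A_k with {i,j,k} = {1,2,3}: the edge opposite A_i. *)
Definition edge_len (A : 'I_3 -> point) (i : 'I_3) : R :=
  dist (A (ordS i)) (A (ordS (ordS i))).
Definition edge_refl (A : 'I_3 -> point) (i : 'I_3) : isom :=
  refl_line (A (ordS i)) (A (ordS (ordS i))).

Definition alg_indep (t : 'I_3 -> R) : Prop :=
  forall p : {mpoly rat[3]}, p != 0 -> (map_mpoly (ratr : rat -> R) p).@[t] != 0.

Definition generic (A : 'I_3 -> point) : Prop :=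
  exists k : R, 0 < k /\ alg_indep (fun i => k * edge_len A i).

End Plane.

(* Main.v *)
Require Import Defs.
From mathcomp Require Import all_boot all_algebra.
From mathcomp Require Import reals.
From mathcomp Require Import mpoly.
From mathcomp Require Import complex ring zify.
Import GRing.Theory Num.Theory.
Local Open Scope ring_scope.

(* Put [a = x1 x2] and [b = x1 x3], so that [w = a b^-1 a^-1 b].  In any group
   satisfying the relations, the conjugates of [w] by the [a^n b^m] generate a
   subgroup normalised by [a] and [b]; since [w] commutes with these
   conjugates, this subgroup is abelian.  Hence every word of even length
   equals [a^n b^m] times a product of conjugates of [w] and of their inverses,
   in every such group simultaneously.  In the plane [a] and [b] are rotations,
   with multipliers [p] and [q] in C, and the conjugate of [w] by [a^n b^m] is
   the translation by [p^n q^m t], where [t <> 0] is that of [w].  So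
   everything reduces to the algebraic independence of [p] and [q] over Q.

   Clearing denominators, a relation between [p] and [q] becomes
   [U + T V = 0], with [U], [V] rational polynomials in the sides and [T] equal
   to [4 i] times the area.  As [T] is imaginary and the sides are
   algebraically independent, [U = V = 0] identically, so the relation also
   holds at degenerate rational "sides" for which [T] becomes rational; these
   realise all pairs of squares [p = x^2], [q = y^2] with [x], [y] rational and
   outside finitely many curves. *)

Set Implicit Arguments.
Unset Strict Implicit.
Unset Printing Implicit Defensive.

Declare Scope grp_scope.
Delimit Scope grp_scope with grp.
Local Infix "**" := gmul (at level 40, left associativity) : grp_scope.
Local Notation "x ^!" := (ginv x) (at level 1, format "x ^!") : grp_scope.
Local Open Scope grp_scope.

(** * Groups generated by two elements *)

Section GroupBasics.
Variable H : group.
Implicit Types x y z : H.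

Lemma gmulK x y : x ** (x^! ** y) = y.
Proof. by rewrite gmulA gmulgV gmul1g. Qed.

Lemma gmulVK x y : x^! ** (x ** y) = y.
Proof. by rewrite gmulA gmulVg gmul1g. Qed.

Lemma gmulI x y z : x ** y = x ** z -> y = z.
Proof. by move=> e; rewrite -(gmulVK x y) e gmulVK. Qed.

Lemma gmulIr x y z : y ** x = z ** x -> y = z.
Proof. by move=> e; rewrite -(gmulg1 y) -(gmulgV x) gmulA e -gmulA gmulgV gmulg1. Qed.

Lemma ginv_eq x y : x ** y = gone H -> x^! = y.
Proof. by move=> e; apply: (@gmulI x); rewrite gmulgV e. Qed.

Lemma ginvM x y : (x ** y)^! = y^! ** x^!.
Proof. by apply: ginv_eq; rewrite -gmulA gmulK gmulgV. Qed.

Lemma ginvK x : x^!^! = x.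
Proof. by apply: ginv_eq; rewrite gmulVg. Qed.

Lemma ginv1 : (gone H)^! = gone H.
Proof. by apply: ginv_eq; rewrite gmul1g. Qed.

Lemma gmulAr x y z : (x ** y) ** z = x ** (y ** z).
Proof. by rewrite gmulA. Qed.

(* The complete rewriting system for free groups: normalising both sides of
   an identity decides it. *)
Definition gE := (gmulAr, ginvM, ginvK, ginv1, gmulgV, gmulVg, gmul1g, gmulg1,
                  gmulK, gmulVK).

Definition gpow x (n : int) : H :=
  match n with
  | Posz k => iter k (gmul x) (gone H)
  | Negz k => iter k.+1 (gmul x^!) (gone H)
  end.

Lemma iter_gmulC k x : iter k (gmul x) (gone H) ** x = x ** iter k (gmul x) (gone H).
Proof. by elim: k => [|k IH] /=; rewrite ?gE // IH. Qed.

Lemma gpow_succ x n : gpow x (n + 1) = gpow x n ** x.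
Proof.
case: n => k.
  by rewrite -PoszD addn1 /= iter_gmulC.
case: k => [|k]; first by rewrite /= !gE.
have -> : Negz k.+1 + 1 = Negz k by rewrite !NegzE -addn1 PoszD opprD addrNK.
by rewrite /gpow [iter k.+2 _ _]iterS -[in RHS]iter_gmulC !gE.
Qed.

Lemma gpow_pred x n : gpow x (n - 1) = gpow x n ** x^!.
Proof. by rewrite -{2}(subrK 1 n) gpow_succ !gE. Qed.

Lemma gpow_ind (x : H) (P : int -> H -> Prop) :
  P 0 (gone H) ->
  (forall n y, P n y -> P (n + 1) (y ** x)) ->
  (forall n y, P n y -> P (n - 1) (y ** x^!)) ->
  forall n, P n (gpow x n).
Proof.
move=> P0 PS PP; elim/int_rect => [|k IH|k IH] //.
  by rewrite -addn1 PoszD gpow_succ; apply: PS.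
by rewrite -addn1 PoszD opprD gpow_pred; apply: PP.
Qed.

Definition gcomm x y := x ** y = y ** x.

Lemma gcommM x y z : gcomm x y -> gcomm x z -> gcomm x (y ** z).
Proof. by rewrite /gcomm => e f; rewrite gmulA e gmulAr f gmulA. Qed.

Lemma gcommV x y : gcomm x y -> gcomm x y^!.
Proof. by rewrite /gcomm => e; apply: (@gmulI y); rewrite gmulA -e !gE. Qed.

Lemma gcomm1 x : gcomm x (gone H).
Proof. by rewrite /gcomm !gE. Qed.

Lemma gcommutatorP x y : x ** (y ** (x^! ** y^!)) = gone H <-> gcomm x y.
Proof.
rewrite /gcomm; split=> [e|e].
  by apply: (@gmulIr (x^! ** y^!)); rewrite !gE.
by rewrite gmulA e !gE.
Qed.

End GroupBasics.

(** * The subgroup generated by the conjugates of a commutator *)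

Section TwoGenerated.
Variables (H : group) (a b : H).

Local Notation w := (a ** b^! ** a^! ** b).
Definition gnm n m := gpow a n ** gpow b m.
Definition wconj n m := (gnm n m)^! ** w ** gnm n m.

(** Only conjugates by the [a^n b^m] are generators; that [a] and [b] normalise this subgroup is
    proved below, in any group. *)
Inductive wclosure : H -> Prop :=
| wclosure1 : wclosure (gone H)
| wclosureM x y : wclosure x -> wclosure y -> wclosure (x ** y)
| wclosureV x : wclosure x -> wclosure x^!
| wclosureW n m : wclosure (wconj n m).

(** Both directions are imposed: in an infinite group a conjugate of a subgroup may be strictly
    smaller than it. *)
Definition wnormal g :=
  forall x, wclosure x -> wclosure (g^! ** x ** g) /\ wclosure (g ** x ** g^!).

Lemma gnm00 : gnm 0 0 = gone H.
Proof. by rewrite /gnm /= !gE. Qed.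

Lemma wconj00 : wconj 0 0 = w.
Proof. by rewrite /wconj gnm00 !gE. Qed.

Lemma wclosure_gen_conj g : (forall n m, wclosure (g^! ** wconj n m ** g)) ->
  forall x, wclosure x -> wclosure (g^! ** x ** g).
Proof.
move=> Wg x; elim=> [|y z _ IHy _ IHz|y _ IHy|//].
- by rewrite !gE; apply: wclosure1.
- have -> : g^! ** (y ** z) ** g = (g^! ** y ** g) ** (g^! ** z ** g).
    by rewrite !gE.
  exact: wclosureM.
have -> : g^! ** y^! ** g = (g^! ** y ** g)^! by rewrite !gE.
exact: wclosureV.
Qed.

Lemma wnormalI g : (forall n m, wclosure (g^! ** wconj n m ** g)) ->
  (forall n m, wclosure (g ** wconj n m ** g^!)) -> wnormal g.
Proof.
move=> W1 W2 x Cx; split; first exact: wclosure_gen_conj.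
rewrite -{1}(ginvK g); apply: wclosure_gen_conj => // n m.
by rewrite ginvK.
Qed.

Lemma wnormal1 : wnormal (gone H).
Proof. by move=> x; rewrite !gE. Qed.

Lemma wnormalM g h : wnormal g -> wnormal h -> wnormal (g ** h).
Proof.
move=> Ng Nh x Cx; split.
  have -> : (g ** h)^! ** x ** (g ** h) = h^! ** (g^! ** x ** g) ** h by rewrite !gE.
  exact: (Nh _ (Ng _ Cx).1).1.
have -> : g ** h ** x ** (g ** h)^! = g ** (h ** x ** h^!) ** g^! by rewrite !gE.
exact: (Ng _ (Nh _ Cx).2).2.
Qed.

Lemma wnormalV g : wnormal g -> wnormal g^!.
Proof. by move=> Ng x Cx; rewrite ginvK; have [] := Ng x Cx. Qed.

Lemma wnormal_pow g n : wnormal g -> wnormal (gpow g n).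
Proof.
move=> Ng; apply: (@gpow_ind H g (fun _ y => wnormal y)) => [|_ y Ny|_ y Ny].
- exact: wnormal1.
- exact: wnormalM.
- by apply: wnormalM => //; apply: wnormalV.
Qed.

Lemma wnormal_b : wnormal b.
Proof.
apply: wnormalI => n m.
  have -> : b^! ** wconj n m ** b = wconj n (m + 1).
    by rewrite /wconj /gnm gpow_succ !gE.
  exact: wclosureW.
have -> : b ** wconj n m ** b^! = wconj n (m - 1).
  by rewrite /wconj /gnm gpow_pred !gE.
exact: wclosureW.
Qed.

(** Each factor [b] picks up a correction [c]; as [b] normalises the closure, earlier corrections
    can be moved to the right past each new factor. *)
Lemma pow_b_conj g c : wclosure c -> g^! ** b ** g = b ** c ->
  forall m, exists2 d, wclosure d & g^! ** gpow b m ** g = gpow b m ** d.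
Proof.
move=> Cc e m; pose P (y : H) := exists2 d, wclosure d & g^! ** y ** g = y ** d.
apply: (@gpow_ind H b (fun=> P)) => [|_ y [d Cd ed]|_ y [d Cd ed]].
- by exists (gone H); rewrite ?gE //; apply: wclosure1.
- exists ((b^! ** d ** b) ** c).
    by apply: wclosureM => //; have [] := wnormal_b Cd.
  have -> : g^! ** (y ** b) ** g = (g^! ** y ** g) ** (g^! ** b ** g) by rewrite !gE.
  by rewrite ed e !gE.
exists (b ** (d ** c^!) ** b^!).
  by have [] := wnormal_b (wclosureM Cd (wclosureV Cc)).
have -> : g^! ** (y ** b^!) ** g = (g^! ** y ** g) ** (g^! ** b ** g)^! by rewrite !gE.
by rewrite ed e !gE.
Qed.

(** The correction comes from [a^-1 b a = b (a^-1 w a)]. *)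
Lemma pow_b_conj_a m :
  exists2 d, wclosure d & a^! ** gpow b m ** a = gpow b m ** d.
Proof.
apply: (@pow_b_conj a (wconj 1 0)); first exact: wclosureW.
by rewrite /wconj /gnm /= !gE.
Qed.

(** The correction comes from [a b a^-1 = b w^-1]. *)
Lemma pow_b_conj_aV m :
  exists2 d, wclosure d & a ** gpow b m ** a^! = gpow b m ** d.
Proof.
rewrite -{1}(ginvK a); apply: (@pow_b_conj a^! (wconj 0 0)^!).
  exact/wclosureV/wclosureW.
by rewrite wconj00 !gE.
Qed.

(** Used with [g] equal to [a] or its inverse: moving [g] past [b^m] costs [d], so the result is
    [wconj n' m] conjugated by an element of the closure. *)
Lemma wconj_conj g n n' m d : wclosure d ->
  g^! ** gpow b m ** g = gpow b m ** d -> gpow a n' = gpow a n ** g ->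
  wclosure (g^! ** wconj n m ** g).
Proof.
move=> Cd ed en; have eg : gnm n m ** g = gnm n' m ** d.
  by rewrite /gnm en !gmulAr -ed !gE.
have -> : g^! ** wconj n m ** g = (gnm n m ** g)^! ** w ** (gnm n m ** g).
  by rewrite /wconj !gE.
have -> : (gnm n m ** g)^! ** w ** (gnm n m ** g) = d^! ** wconj n' m ** d.
  by rewrite eg /wconj !gE.
by apply: wclosureM => //; apply: wclosureM; [apply: wclosureV | apply: wclosureW].
Qed.

Lemma wnormal_a : wnormal a.
Proof.
apply: wnormalI => n m.
  have [d Cd ed] := pow_b_conj_a m.
  by apply: (wconj_conj Cd ed); apply: gpow_succ.
have [d Cd ed] := pow_b_conj_aV m.
rewrite -{1}(ginvK a); apply: (wconj_conj Cd); last exact: gpow_pred.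
by rewrite ginvK.
Qed.

Definition wnf x := exists n m, exists2 c, wclosure c & x = gnm n m ** c.

Lemma wnf1 : wnf (gone H).
Proof. by exists 0, 0, (gone H); [apply: wclosure1 | rewrite gnm00 !gE]. Qed.

Lemma wnf_b x : wnf x -> wnf (x ** b) /\ wnf (x ** b^!).
Proof.
case=> n [m [c /wnormal_b [C1 C2] ->]]; split.
  by exists n, (m + 1), (b^! ** c ** b); rewrite // /gnm gpow_succ !gE.
by exists n, (m - 1), (b ** c ** b^!); rewrite // /gnm gpow_pred !gE.
Qed.

Lemma wnf_a x : wnf x -> wnf (x ** a) /\ wnf (x ** a^!).
Proof.
case=> n [m [c /wnormal_a [C1 C2] ->]]; split.
  have [d Cd ed] := pow_b_conj_a m.
  exists (n + 1), m, (d ** (a^! ** c ** a)); first exact: wclosureM.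
  by rewrite /gnm gpow_succ !gmulA (gmulAr _ (gpow b m) d) -ed !gE.
have [d Cd ed] := pow_b_conj_aV m.
exists (n - 1), m, (d ** (a ** c ** a^!)); first exact: wclosureM.
by rewrite /gnm gpow_pred !gmulA (gmulAr _ (gpow b m) d) -ed !gE.
Qed.

(** Only positive powers occur; lists of exponents let products be compared up to permutation. *)
Definition wprod (s : seq (int * int)) : H :=
  foldr (fun k x => wconj k.1 k.2 ** x) (gone H) s.

Lemma wprod_cat s t : wprod (s ++ t) = wprod s ** wprod t.
Proof. by elim: s => [|k s IH] /=; rewrite ?IH !gE. Qed.

Lemma wclosure_prod s : wclosure (wprod s).
Proof.
elim: s => [|k s IH]; first exact: wclosure1.
by apply: wclosureM => //; apply: wclosureW.
Qed.

Hypothesis wcomm_w : forall n m, gcomm w (wconj n m).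

Lemma wclosure_comm_w x : wclosure x -> gcomm w x.
Proof.
elim=> [|y z _ IHy _ IHz|y _ IHy|n m].
- exact: gcomm1.
- exact: gcommM.
- exact: gcommV.
- exact: wcomm_w.
Qed.

(* Only [w] is assumed to be central in the closure; as the closure is normal,
   so are the conjugates of [w]. *)
Lemma wclosure_abelian x y : wclosure x -> wclosure y -> gcomm x y.
Proof.
move=> Cx; elim=> [|y1 y2 _ IH1 _ IH2|y1 _ IH|n m].
- exact: gcomm1.
- exact: gcommM.
- exact: gcommV.
have Ng : wnormal (gnm n m).
  by apply: wnormalM; apply: wnormal_pow; [apply: wnormal_a | apply: wnormal_b].
have := wclosure_comm_w (Ng _ Cx).2; rewrite /gcomm => e.
(* Conjugation by [gnm n m] reduces the claim to the commutation of [w] with the conjugate of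
   [x]. *)
have -> : x = (gnm n m)^! ** (gnm n m ** x ** (gnm n m)^!) ** gnm n m by rewrite !gE.
move: (gnm n m ** x ** _) e => z e; rewrite /wconj.
transitivity ((gnm n m)^! ** (z ** w) ** gnm n m); first by rewrite !gE.
by rewrite -e !gE.
Qed.

Lemma wprod_perm s t : perm_eq s t -> wprod s = wprod t.
Proof.
move=> st; apply: (@catCA_perm_ind _ (fun t => wprod s = wprod t) _ _ _ st) => //.
move=> s1 s2 s3 ->; rewrite !wprod_cat !gmulA; congr gmul.
by apply: wclosure_abelian; apply: wclosure_prod.
Qed.

(** Fractions avoid signed multiplicities: inversion exchanges [s] and [t], and multiplication
    concatenates the lists, by commutativity. *)
Lemma wclosure_fraction x : wclosure x ->
  exists s t, x ** wprod t = wprod s.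
Proof.
elim=> [|y z Cy [s1 [t1 e1]] Cz [s2 [t2 e2]]|y Cy [s [t e]]|n m].
- by exists [::], [::]; rewrite !gE.
- exists (s1 ++ s2), (t1 ++ t2); rewrite !wprod_cat -e1 -e2 !gE.
  congr gmul; rewrite !gmulA; congr gmul.
  exact: wclosure_abelian Cz (wclosure_prod _).
- by exists t, s; rewrite -e !gE.
by exists [:: (n, m)], [::]; rewrite /= !gE.
Qed.

End TwoGenerated.

(** * Words evaluated at three involutions *)

Section Words.
Variables (H : group) (h : 'I_3 -> H).

Lemma eval_word_cat u v : eval_word h (u ++ v) = eval_word h u ** eval_word h v.
Proof. by elim: u => [|l u IH] /=; rewrite ?IH !gE. Qed.

Lemma eval_word_inv u : eval_word h (winv u) = (eval_word h u)^!.
Proof.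
elim: u => [|[i e] u IH]; rewrite /winv /=; first by rewrite !gE.
rewrite rev_cons -cats1 eval_word_cat IH !gE /= /eval_letter /= gmulg1.
by case: e => /=; rewrite ?ginvK.
Qed.

Lemma eval_word_pow u n : eval_word h (wpow u n) = gpow (eval_word h u) n.
Proof.
have pow v k : eval_word h (flatten (nseq k v)) = iter k (gmul (eval_word h v)) (gone H).
  by elim: k => //= k <-; rewrite eval_word_cat.
by case: n => k; rewrite /gpow -?eval_word_inv; apply: pow.
Qed.

Lemma eval_wcomm u v : eval_word h (wcomm u v) = gone H <->
  gcomm (eval_word h u) (eval_word h v).
Proof. by rewrite -gcommutatorP /wcomm !eval_word_cat !eval_word_inv. Qed.

Lemma relator_evalP : (forall r, is_relator r -> eval_word h r = gone H) <->
  (forall i, h i ** h i = gone H) /\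
  (forall n m, (n, m) <> (0, 0) ->
     gcomm (eval_word h w_word)
       (eval_word h (winv (g_word n m) ++ w_word ++ g_word n m))).
Proof.
split=> [rel|[inv com] r [[i ->]|[n [m [nz ->]]]]].
- split=> [i|n m nz].
    have := rel (xgen i ++ xgen i); rewrite /= !gE; apply.
    by left; exists i.
  by apply/eval_wcomm/rel; right; exists n, m.
- by rewrite /= !gE; apply: inv.
exact/eval_wcomm/com.
Qed.

Hypothesis h_invol : forall i, h i ** h i = gone H.
Local Notation a := (h x1 ** h x2).
Local Notation b := (h x1 ** h x3).

Lemma invol_inv i : (h i)^! = h i.
Proof. exact/ginv_eq/h_invol. Qed.

(** For involutions [b^-1 = x3 x1] and [a^-1 = x2 x1], so the right side reduces to
    [x1 x2 x3 x1 x2 x3]. *)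
Lemma eval_w_word : eval_word h w_word = a ** b^! ** a^! ** b.
Proof.
by rewrite /= /eval_letter /= !gE !invol_inv.
Qed.

Lemma eval_g_word n m : eval_word h (g_word n m) = gnm a b n m.
Proof. by rewrite /g_word eval_word_cat !eval_word_pow /= !gE. Qed.

Lemma eval_w_conj n m :
  eval_word h (winv (g_word n m) ++ w_word ++ g_word n m) = wconj a b n m.
Proof.
rewrite eval_word_cat (eval_word_cat w_word) eval_word_inv eval_w_word.
by rewrite eval_g_word /wconj !gE.
Qed.

Lemma ord3_ind (P : 'I_3 -> Prop) : P x1 -> P x2 -> P x3 -> forall i, P i.
Proof.
move=> P1 P2 P3 [[|[|[|//]]] lt_i]; first by rewrite (bool_irrelevance lt_i isT).
  by rewrite (bool_irrelevance lt_i isT).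
by rewrite (bool_irrelevance lt_i isT).
Qed.

(** An odd word is completed by [x1] to an even one. A new letter [x_i] then contributes [x1 x_i] or
    its inverse, that is [1], [a] or [b] up to inversion. *)
Lemma eval_word_wnf u :
  if odd (size u) then wnf a b (eval_word h u ** h x1) else wnf a b (eval_word h u).
Proof.
elim/last_ind: u => [|u [i e] IH]; first exact: wnf1.
have -> : eval_word h (rcons u (i, e)) = eval_word h u ** h i.
  rewrite -cats1 eval_word_cat /= gmulg1 /eval_letter /=.
  by case: e; rewrite ?invol_inv.
rewrite size_rcons /=; case: (odd (size u)) IH => /= IH.
  have -> : eval_word h u ** h i = (eval_word h u ** h x1) ** (h x1 ** h i).
    by rewrite !gmulA (gmulAr _ (h x1) (h x1)) h_invol !gE.
  elim/ord3_ind: i => [||]; first by rewrite h_invol gmulg1.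
    by have [] := wnf_a IH.
  by have [] := wnf_b IH.
have -> : eval_word h u ** h i ** h x1 = eval_word h u ** (h x1 ** h i)^!.
  by rewrite !gE !invol_inv.
elim/ord3_ind: i => [||]; first by rewrite h_invol ginv1 gmulg1.
  by have [] := wnf_a IH.
by have [] := wnf_b IH.
Qed.

End Words.

(** * Direct products of groups *)

Section ProdGroup.
Variables H K : group.

(** A normal form found in a product has the same exponents and lists in both factors; this carries
    relations from the plane to an arbitrary group. *)
Definition prod_group : group.
refine (@Defs.Group (H * K)%type (fun x y => (x.1 ** y.1, x.2 ** y.2))
  (fun x => (x.1^!, x.2^!)) (gone H, gone K) _ _ _ _ _).
- by move=> x y z; rewrite /= !gE.
- by case=> x y; rewrite /= !gE.
- by case=> x y; rewrite /= !gE.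
- by move=> x; rewrite /= !gE.
- by move=> x; rewrite /= !gE.
Defined.

Variable h : 'I_3 -> prod_group.

Lemma eval_word_prod u :
  eval_word h u = (eval_word (fst \o h) u, eval_word (snd \o h) u).
Proof. by elim: u => //= -[i e] u ->; case: e. Qed.

Lemma gpow_prod (x : prod_group) n : gpow x n = (gpow x.1 n, gpow x.2 n).
Proof.
have iterE k (y : prod_group) : iter k (gmul y) (gone prod_group) =
    (iter k (gmul y.1) (gone H), iter k (gmul y.2) (gone K)).
  by elim: k => //= k ->.
by case: n => k; apply: iterE.
Qed.

Lemma gnm_prod (a b : prod_group) n m :
  gnm a b n m = (gnm a.1 b.1 n m, gnm a.2 b.2 n m).
Proof. by rewrite /gnm !gpow_prod. Qed.

Lemma wconj_prod (a b : prod_group) n m :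
  wconj a b n m = (wconj a.1 b.1 n m, wconj a.2 b.2 n m).
Proof. by rewrite /wconj !gnm_prod. Qed.

Lemma wprod_prod (a b : prod_group) s :
  wprod a b s = (wprod a.1 b.1 s, wprod a.2 b.2 s).
Proof.
elim: s => // k s IH; rewrite -[LHS]/(wconj a b k.1 k.2 ** wprod a b s) IH.
by rewrite wconj_prod.
Qed.

End ProdGroup.

(** * Algebraic independence of the rotation multipliers *)

Local Open Scope complex_scope.

(** Infinitely many roots force [P = 0]; starting at [2] avoids the values [0] and [1], excluded
    below. *)
Lemma poly_eq0_nat (P : {poly rat}) :
  (forall z : nat, (1 < z)%N -> P.[z%:R] = 0) -> P = 0.
Proof.
move=> Pz; apply/eqP; apply: contraT => nzP.
pose rs : seq rat := mkseq (fun i => i.+2%:R) (size P).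
have rootP : all (root P) rs by apply/allP => _ /mapP[i _ ->]; apply/rootP/Pz.
have := max_poly_roots nzP rootP; rewrite size_mkseq ltnn; apply.
rewrite map_inj_uniq ?iota_uniq // => i j /eqP.
by rewrite eqr_nat => /eqP [].
Qed.

Lemma sum_Xn_perm (s t : seq nat) :
  \sum_(i <- s) 'X^i = \sum_(i <- t) 'X^i :> {poly rat} -> perm_eq s t.
Proof.
move=> e; apply/allP => k _ /=; apply/eqP.
have coefS r : (\sum_(i <- r) 'X^i : {poly rat})`_k = (count_mem k r)%:R.
  rewrite coef_sum; elim: r => [|i r IH]; rewrite ?big_nil // big_cons IH.
  by rewrite coefXn natrD eq_sym.
by apply/eqP; rewrite -(eqr_nat rat) -!coefS e.
Qed.

(* Kronecker substitution [x = z, y = z ^ M]. *)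
Lemma monomial_sums_perm (s t : seq (nat * nat)) :
  (forall x y : rat, x != 0 -> y != 0 -> x ^+ 2 != 1 -> y ^+ 2 != 1 ->
     x ^+ 2 != y ^+ 2 ->
     \sum_(k <- s) (x ^+ 2) ^+ k.1 * (y ^+ 2) ^+ k.2 =
     \sum_(k <- t) (x ^+ 2) ^+ k.1 * (y ^+ 2) ^+ k.2) ->
  perm_eq s t.
Proof.
(* [M] exceeds every first exponent, so base [M] digits are unambiguous; [M >= 2] also gives
   [x ^+ 2 != y ^+ 2]. *)
move=> e; pose M := (\max_(k <- s ++ t) k.1).+2.
have ltM k : k \in s ++ t -> (k.1 < M)%N.
  by move=> kst; rewrite /M ltnS leqW // leq_bigmax_seq.
pose enc (k : nat * nat) := (2 * (k.2 * M + k.1))%N.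
pose dec j := ((j %/ 2) %% M, (j %/ 2) %/ M)%N.
have encK r : {subset r <= s ++ t} -> map dec (map enc r) = r.
  move=> sub; rewrite -map_comp -[RHS]map_id; apply/eq_in_map => -[i j] /sub/ltM /= ltiM.
  by rewrite /dec /enc mulKn //= modnMDl modn_small // divnMDl // divn_small // addn0.
suff /(perm_map dec) : perm_eq (map enc s) (map enc t).
  by rewrite !encK // => k ks; rewrite mem_cat ks ?orbT.
apply/sum_Xn_perm/eqP; rewrite -subr_eq0; apply/eqP/poly_eq0_nat => z z_gt1.
rewrite hornerD hornerN !horner_sum !big_map; apply/eqP; rewrite subr_eq0; apply/eqP.
have term (k : nat * nat) : 'X^(enc k).[z%:R : rat] =
    (z%:R ^+ 2) ^+ k.1 * ((z%:R ^+ M) ^+ 2) ^+ k.2.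
  rewrite hornerXn /enc -!exprM -exprD; congr (_ ^+ _); lia.
under eq_bigr do rewrite term; under [RHS]eq_bigr do rewrite term.
have z0 : (z%:R : rat) != 0 by rewrite pnatr_eq0; lia.
have ze i j : ((z%:R : rat) ^+ i == z%:R ^+ j) = (i == j).
  by rewrite -!natrX eqr_nat eqn_exp2l.
apply: e; rewrite ?expf_neq0 //.
- by rewrite (ze 2 0).
- by rewrite -exprM (ze _ 0); lia.
by rewrite -exprM ze; lia.
Qed.

Lemma horner_map_even_odd (B S : comNzRingType) (f : {rmorphism B -> S})
    (Z : {poly B}) (d : B) (z : S) : z ^+ 2 = f d ->
  (map_poly f Z).[z] = f (even_poly Z).[d] + f (odd_poly Z).[d] * z.
Proof.
move=> zd; rewrite -{1}(poly_even_odd Z) rmorphD rmorphM /= map_polyX.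
rewrite hornerD hornerMX !map_comp_poly !horner_comp !map_polyXn !hornerXn zd.
by rewrite !horner_map.
Qed.

(** At the imaginary point [y *i] the even part of [Z] gives the real part and the odd part gives
    the imaginary part. Both vanish, hence vanish already in [B] by injectivity of [f], and so under
    [g]. *)
Lemma horner_transfer (R : rcfType) (B S : comNzRingType)
    (f : {rmorphism B -> R}) (g : {rmorphism B -> S}) (Z : {poly B}) (d : B)
    (y : R) (z : S) :
  (forall x, f x = 0 -> x = 0) -> y != 0 -> y ^+ 2 = - f d -> z ^+ 2 = g d ->
  (map_poly (real_complex R \o f) Z).[y *i] = 0 -> (map_poly g Z).[z] = 0.
Proof.
move=> f0 y0 yd zd; rewrite (horner_map_even_odd Z zd).
have yd' : (y *i) ^+ 2 = (real_complex R \o f) d :> R[i].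
  rewrite expr2; apply/eqP; rewrite eq_complex /=.
  by rewrite !mulr0 !mul0r sub0r -expr2 yd opprK addr0 !eqxx.
rewrite (horner_map_even_odd Z yd').
move=> /eqP; rewrite eq_complex /= !mul0r mulr0 subr0 addr0 add0r addr0.
rewrite mulf_eq0 (negPf y0) orbF => /andP[/eqP/f0 -> /eqP/f0 ->].
by rewrite rmorph0 mul0r addr0.
Qed.

Section ClearedSum.
Variables (S : comNzRingType) (N : nat) (u d v e : S).

(** The sum of the [p^i q^j] with [p = u^2 / d] and [q = v^2 / e], multiplied by the common
    denominator [d^N e^N]; the truncated subtractions are exact once [N] bounds the exponents. *)
Definition cleared_sum (s : seq (nat * nat)) : S :=
  \sum_(k <- s) (u ^+ 2) ^+ k.1 * d ^+ (N - k.1) * ((v ^+ 2) ^+ k.2 * e ^+ (N - k.2)).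

Lemma cleared_sumE p q s : u ^+ 2 = p * d -> v ^+ 2 = q * e ->
  (forall k, k \in s -> (k.1 <= N)%N && (k.2 <= N)%N) ->
  cleared_sum s = d ^+ N * e ^+ N * \sum_(k <- s) p ^+ k.1 * q ^+ k.2.
Proof.
move=> ud ve leN; rewrite /cleared_sum mulr_sumr; apply: eq_big_seq => k /leN.
case/andP=> le1 le2; rewrite ud ve !exprMn.
have -> : d ^+ N = d ^+ (N - k.1) * d ^+ k.1 by rewrite -exprD subnK.
have -> : e ^+ N = e ^+ (N - k.2) * e ^+ k.2 by rewrite -exprD subnK.
ring.
Qed.
End ClearedSum.

Lemma rmorph_cleared_sum (S T : comNzRingType) (f : {rmorphism S -> T}) N u d v e s :
  f (cleared_sum N u d v e s) = cleared_sum N (f u) (f d) (f v) (f e) s.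
Proof.
rewrite /cleared_sum rmorph_sum; apply: eq_bigr => k _.
by rewrite !rmorphM !rmorphXn.
Qed.

(* For side lengths [l] the law of cosines makes [cosside i j k l] twice the
   scalar product of the sides [i] and [j]. *)
Definition cosside (S : comNzRingType) (i j k : 'I_3) (l : 'I_3 -> S) : S :=
  l k ^+ 2 - l i ^+ 2 - l j ^+ 2.
(** By Heron's formula, [sqprod - cosside ^+ 2] is 16 times the squared area. *)
Definition sqprod (S : comNzRingType) (i j : 'I_3) (l : 'I_3 -> S) : S :=
  4 * l i ^+ 2 * l j ^+ 2.

Lemma rmorph_cosside (S T : comNzRingType) (f : {rmorphism S -> T}) i j k l :
  f (cosside i j k l) = cosside i j k (f \o l).
Proof. by rewrite /cosside !rmorphB !rmorphXn. Qed.

Lemma rmorph_sqprod (S T : comNzRingType) (f : {rmorphism S -> T}) i j l :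
  f (sqprod i j l) = sqprod i j (f \o l).
Proof. by rewrite /sqprod 2!rmorphM 2!rmorphXn rmorph_nat. Qed.

Lemma cosside_ext (S : comNzRingType) i j k (l l' : 'I_3 -> S) : l =1 l' ->
  cosside i j k l = cosside i j k l'.
Proof. by move=> e; rewrite /cosside !e. Qed.

Lemma sqprod_ext (S : comNzRingType) i j (l l' : 'I_3 -> S) : l =1 l' ->
  sqprod i j l = sqprod i j l'.
Proof. by move=> e; rewrite /sqprod !e. Qed.

(** The variable ['X] stands for [i sigma], a square root of [cosside ^+ 2 - sqprod], which is not a
    polynomial in the sides. *)
Definition side_poly (B : comNzRingType) (N : nat) (l : 'I_3 -> B) r : {poly B} :=
  cleared_sum N ((cosside x1 x2 x3 l)%:P + 'X) (sqprod x1 x2 l)%:P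
    ((cosside x1 x3 x2 l)%:P - 'X) (sqprod x1 x3 l)%:P r.

Lemma horner_side_poly (B T : comNzRingType) (h : {rmorphism B -> T}) N z l l' r :
  h \o l =1 l' -> (map_poly h (side_poly N l r)).[z] =
  cleared_sum N (cosside x1 x2 x3 l' + z) (sqprod x1 x2 l')
    (cosside x1 x3 x2 l' - z) (sqprod x1 x3 l') r.
Proof.
move=> hl; pose ev : {rmorphism {poly B} -> T} := horner_eval z \o map_poly h.
have evC c : ev c%:P = h c by rewrite /= map_polyC horner_evalE hornerC.
have evX : ev 'X = z by rewrite /= map_polyX horner_evalE hornerX.
have evD c : ev (c%:P + 'X) = h c + z by rewrite rmorphD evC evX.
have evB c : ev (c%:P - 'X) = h c - z by rewrite rmorphB evC evX.
rewrite -[LHS]/(ev _) rmorph_cleared_sum evD evB !evC.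
rewrite !rmorph_cosside !rmorph_sqprod.
by rewrite !(cosside_ext _ _ _ hl) !(sqprod_ext _ _ hl).
Qed.

(* The solution [l] of [l1 + l2 x + l3 y = 0] and [l1 + l2 / x + l3 / y = 0]. *)
Definition split_sides (x y : rat) (i : 'I_3) : rat :=
  match val i with
  | 0%N => x / y - y / x
  | 1%N => y - y^-1
  | _ => x^-1 - x
  end.

(** * Independence of the monomials in the multipliers *)

Section GenericSides.
Variables (R : realType) (L : 'I_3 -> R) (sigma : R) (p q : R[i]).
Hypothesis L_indep : alg_indep L.
Hypothesis sigma_neq0 : sigma != 0.
Hypothesis sigma_sq : sigma ^+ 2 = sqprod x1 x2 L - cosside x1 x2 x3 L ^+ 2.
Hypothesis p_def : (cosside x1 x2 x3 L +i* sigma) ^+ 2 = p * (sqprod x1 x2 L)%:C.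
Hypothesis q_def : (cosside x1 x3 x2 L -i* sigma) ^+ 2 = q * (sqprod x1 x3 L)%:C.

Let Xs (i : 'I_3) : {mpoly rat[3]} := 'X_i.
Let f : {rmorphism {mpoly rat[3]} -> R} := meval L \o map_mpoly (ratr : rat -> R).

Lemma f_eq0 x : f x = 0 -> x = 0.
Proof. by apply: contra_eq => /L_indep. Qed.

Lemma f_Xs : f \o Xs =1 L.
Proof. by move=> i; rewrite /= map_mpolyX mevalXU. Qed.

(** The cleared relation is the vanishing of [Z s - Z t] at [i sigma]. It transfers to the sides
    [split_sides x y], where [p] and [q] become [x^2] and [y^2], and rational substitution recovers
    the exponents. *)
Lemma generic_sums_nat (s t : seq (nat * nat)) :
  \sum_(k <- s) p ^+ k.1 * q ^+ k.2 = \sum_(k <- t) p ^+ k.1 * q ^+ k.2 ->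
  perm_eq s t.
Proof.
move=> est; pose N := \max_(k <- s ++ t) (k.1 + k.2)%N.
have leN (r : seq (nat * nat)) : {subset r <= s ++ t} ->
    forall k, k \in r -> (k.1 <= N)%N && (k.2 <= N)%N.
  move=> sub k /sub kst; have := @leq_bigmax_seq _ (s ++ t) xpredT (fun k => k.1 + k.2)%N k kst isT.
  by rewrite -/N; lia.
have leNs : forall k, k \in s -> (k.1 <= N)%N && (k.2 <= N)%N.
  by apply: leN => k ks; rewrite mem_cat ks.
have leNt : forall k, k \in t -> (k.1 <= N)%N && (k.2 <= N)%N.
  by apply: leN => k ks; rewrite mem_cat ks orbT.
pose Z := side_poly N Xs.
have ZC : (map_poly (real_complex R \o f) (Z s - Z t)).[sigma *i] = 0.
  have fL : (real_complex R \o f) \o Xs =1 real_complex R \o L.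
    by move=> i; congr (real_complex R _); apply: f_Xs.
  rewrite rmorphB hornerD hornerN !(horner_side_poly _ _ _ fL).
  rewrite -!rmorph_cosside -!rmorph_sqprod.
  have eA : (cosside x1 x2 x3 L)%:C + sigma *i = cosside x1 x2 x3 L +i* sigma.
    by apply/eqP; rewrite eq_complex /= addr0 add0r !eqxx.
  have eB : (cosside x1 x3 x2 L)%:C - sigma *i = cosside x1 x3 x2 L -i* sigma.
    by apply/eqP; rewrite eq_complex /= subr0 add0r !eqxx.
  by rewrite eA eB !(cleared_sumE p_def q_def) // est subrr.
apply: monomial_sums_perm => x y x0 y0 x1n y1n xy.
pose l := split_sides x y; pose g : {rmorphism {mpoly rat[3]} -> rat} := meval l.
have gl : g \o Xs =1 l by move=> i; rewrite /= mevalXU.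
(* Here [cosside x1 x2 x3 l] is [l x1 * l x2 * (x + x^-1)], so adding [z] gives
   [2 * l x1 * l x2 * x]; likewise [cosside x1 x3 x2 l - z] is [2 * l x1 * l x3 * y]. *)
pose z := l x1 * l x2 * (x - x^-1).
have : (map_poly g (Z s - Z t)).[z] = 0.
  apply: (@horner_transfer _ _ _ f g _ 
     (cosside x1 x2 x3 Xs ^+ 2 - sqprod x1 x2 Xs) _ _ f_eq0 sigma_neq0) ZC.
    rewrite rmorphB rmorphXn rmorph_cosside rmorph_sqprod opprB.
    by rewrite (cosside_ext _ _ _ f_Xs) (sqprod_ext _ _ f_Xs).
  rewrite rmorphB rmorphXn rmorph_cosside rmorph_sqprod.
  rewrite (cosside_ext _ _ _ gl) (sqprod_ext _ _ gl).
  rewrite /z /cosside /sqprod /l /split_sides /=; field; exact/andP.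
rewrite rmorphB hornerD hornerN !(horner_side_poly _ _ _ gl).
have eA : (cosside x1 x2 x3 l + z) ^+ 2 = x ^+ 2 * sqprod x1 x2 l.
  rewrite /z /cosside /sqprod /l /split_sides /=; field; exact/andP.
have eB : (cosside x1 x3 x2 l - z) ^+ 2 = y ^+ 2 * sqprod x1 x3 l.
  rewrite /z /cosside /sqprod /l /split_sides /=; field; exact/andP.
(* The excluded curves are exactly those on which a side vanishes and the cleared denominator could
   not be cancelled. *)
have l1 : l x1 != 0.
  have -> : l x1 = (x ^+ 2 - y ^+ 2) / (x * y).
    by rewrite /l /split_sides /=; field; apply/andP.
  by rewrite mulf_neq0 ?invr_eq0 ?mulf_neq0 // subr_eq0.
have l2 : l x2 != 0.
  have -> : l x2 = (y ^+ 2 - 1) / y by rewrite /l /split_sides /=; field.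
  by rewrite mulf_neq0 ?invr_eq0 // subr_eq0.
have l3 : l x3 != 0.
  have -> : l x3 = - ((x ^+ 2 - 1) / x) by rewrite /l /split_sides /=; field.
  by rewrite oppr_eq0 mulf_neq0 ?invr_eq0 // subr_eq0.
rewrite !(cleared_sumE eA eB) // -mulrBr => /eqP; rewrite mulf_eq0 => /orP[|].
  by apply: contraTeq => _; rewrite /sqprod !(mulf_neq0, expf_neq0).
by rewrite subr_eq0 => /eqP.
Qed.
Lemma p_neq0 : p != 0.
Proof.
apply: contraNneq sigma_neq0 => p0; move: p_def; rewrite p0 mul0r => /eqP.
by rewrite expf_eq0 eq_complex /= => /andP[].
Qed.

Lemma q_neq0 : q != 0.
Proof.
apply: contraNneq sigma_neq0 => q0; move: q_def; rewrite q0 mul0r => /eqP.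
by rewrite expf_eq0 eq_complex /= oppr_eq0 => /andP[].
Qed.

(** Multiplication by [p^N q^N] makes all exponents nonnegative, so the absolute values in [enc]
    lose nothing. *)
Lemma generic_sums_int (s t : seq (int * int)) :
  \sum_(k <- s) p ^ k.1 * q ^ k.2 = \sum_(k <- t) p ^ k.1 * q ^ k.2 ->
  perm_eq s t.
Proof.
move=> est; pose N := \max_(k <- s ++ t) (`|k.1| + `|k.2|)%N.
have leN k : k \in s ++ t -> (`|k.1| + `|k.2| <= N)%N.
  by move=> kst; apply: (@leq_bigmax_seq _ _ xpredT (fun k => `|k.1| + `|k.2|)%N).
pose enc (k : int * int) := (`|(k.1 + N%:Z)%R|%N, `|(k.2 + N%:Z)%R|%N).
pose dec (k : nat * nat) := (k.1%:Z - N%:Z, k.2%:Z - N%:Z).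
have encK r : {subset r <= s ++ t} -> map dec (map enc r) = r.
  move=> sub; rewrite -map_comp -[RHS]map_id; apply/eq_in_map => -[i j] /sub/leN /= le.
  by rewrite /dec /enc /=; congr pair; lia.
have ss : {subset s <= s ++ t} by move=> k ks; rewrite mem_cat ks.
have ts : {subset t <= s ++ t} by move=> k kt; rewrite mem_cat kt orbT.
suff /(perm_map dec) : perm_eq (map enc s) (map enc t) by rewrite !encK.
have encE r : {subset r <= s ++ t} ->
    \sum_(k <- map enc r) p ^+ k.1 * q ^+ k.2 =
    p ^ N%:Z * q ^ N%:Z * \sum_(k <- r) p ^ k.1 * q ^ k.2.
  move=> sub; rewrite big_map mulr_sumr; apply: eq_big_seq => -[i j] /sub/leN /= le.
  have -> : p ^+ `|(i + N%:Z)%R|%N = p ^ (i + N%:Z) by rewrite exprnP; congr (p ^ _); lia.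
  have -> : q ^+ `|(j + N%:Z)%R|%N = q ^ (j + N%:Z) by rewrite exprnP; congr (q ^ _); lia.
  by rewrite !expfzDr ?p_neq0 ?q_neq0 //; ring.
by apply: generic_sums_nat; rewrite !encE // est.
Qed.

Lemma generic_mul_indep n m : p ^ n * q ^ m = 1 -> n = 0 /\ m = 0.
Proof.
move=> e; have : perm_eq [:: (n, m)] [:: (0, 0)].
  by apply: generic_sums_int; rewrite !big_seq1 /= e !expr0z mulr1.
by move/perm_mem/(_ (n, m)); rewrite !inE eqxx => /esym/eqP[].
Qed.

Lemma generic_neq1 : p != 1 /\ q != 1.
Proof.
split; apply/eqP => e; first by have [] := @generic_mul_indep 1 0; rewrite ?e ?expr0z ?mul1r.
by have [] := @generic_mul_indep 0 1; rewrite ?e ?expr0z ?mul1r.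
Qed.

End GenericSides.

(** * Plane isometries *)

Section Isometries.
Variable R : realType.
Implicit Types (g h : isom R) (M : 'M[R]_2) (P Q v : point R).

Definition orthogonal_isom g := g.1 *m g.1^T == 1%:M.

Lemma orthogonal_isom_one : orthogonal_isom (isom_one R).
Proof. by rewrite /orthogonal_isom trmx1 mulmx1. Qed.

Lemma orthogonal_isom_mul g h :
  orthogonal_isom g -> orthogonal_isom h -> orthogonal_isom (isom_mul g h).
Proof.
move=> /eqP og /eqP oh; apply/eqP.
by rewrite /= trmx_mul mulmxA -(mulmxA g.1) oh mulmx1.
Qed.

Lemma orthogonal_isom_inv g : orthogonal_isom g -> orthogonal_isom (isom_inv g).
Proof. by move=> /eqP/mulmx1C og; apply/eqP; rewrite /= trmxK. Qed.

(** The restriction to orthogonal parts makes [isom_inv], defined by a transpose, a true inverse. *)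
Definition eucl := {g : isom R | orthogonal_isom g}.
Definition eucl_one : eucl := exist (fun g => is_true (orthogonal_isom g)) _ orthogonal_isom_one.
Definition eucl_mul (g h : eucl) : eucl :=
  exist (fun g => is_true (orthogonal_isom g)) _ (orthogonal_isom_mul (valP g) (valP h)).
Definition eucl_inv (g : eucl) : eucl := exist (fun g => is_true (orthogonal_isom g)) _ (orthogonal_isom_inv (valP g)).

Definition eucl_group : group.
refine (@Defs.Group eucl eucl_mul eucl_inv eucl_one _ _ _ _ _).
- move=> x y z; apply: val_inj; rewrite /= /isom_mul /=.
  by rewrite mulmxDl !mulmxA addrA.
- by case=> -[M v] o; apply: val_inj; rewrite /= /isom_mul /= mul1mx mul0mx add0r.
- by case=> -[M v] o; apply: val_inj; rewrite /= /isom_mul /= !mulmx1 addr0.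
- case=> -[M v] /= o; apply: val_inj; rewrite /= /isom_mul /isom_one /=.
  by move/eqP/mulmx1C: o => /= o; rewrite o mulNmx -mulmxA o mulmx1 addNr.
- case=> -[M v] /= o; apply: val_inj; rewrite /= /isom_mul /isom_one /=.
  by move/eqP: o => /= ->; rewrite subrr.
Defined.

Lemma eval_word_eucl (h : 'I_3 -> eucl_group) u :
  val (eval_word h u) = eval_isom (fun i => val (h i)) u.
Proof. by elim: u => //= -[i e] u <-; case: e. Qed.

Definition cvec v : R[i] := v 0 0 +i* v 0 1.
(** Only the shape of the matrix is recorded. Since vectors are rows, the first row read in C is the
    multiplier. *)
Definition rotation M := M 1 1 = M 0 0 /\ M 1 0 = - M 0 1.
Definition reflection M := M 1 1 = - M 0 0 /\ M 1 0 = M 0 1.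

Lemma mulmx2E m (N : 'M[R]_(m, 2)) M i j : (N *m M) i j = N i 0 * M 0 j + N i 1 * M 1 j.
Proof. by rewrite mxE !big_ord_recl big_ord0 addr0 (_ : lift ord0 ord0 = 1) //; apply: val_inj. Qed.

Lemma rotation1 : rotation 1%:M.
Proof. by split; rewrite !mxE //= oppr0. Qed.

Lemma rotationM M N : rotation M -> rotation N -> rotation (M *m N).
Proof. by move=> [m1 m2] [n1 n2]; split; rewrite !mulmx2E m1 m2 n1 n2; ring. Qed.

Lemma rotationV M : rotation M -> rotation M^T.
Proof. by move=> [m1 m2]; split; rewrite !mxE // m2 opprK. Qed.

Lemma reflection_mul M N : reflection M -> reflection N -> rotation (M *m N).
Proof. by move=> [m1 m2] [n1 n2]; split; rewrite !mulmx2E m1 m2 n1 n2; ring. Qed.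

Lemma reflection_mulr M N : reflection M -> rotation N -> reflection (M *m N).
Proof. by move=> [m1 m2] [n1 n2]; split; rewrite !mulmx2E m1 m2 n1 n2; ring. Qed.

Lemma reflection1 : ~ reflection 1%:M.
Proof.
case; rewrite !mxE /= => /eqP; rewrite -subr_eq0 opprK => /eqP e _.
by have := pnatr_eq0 R 2; rewrite -[2%:R]/(1 + 1) e eqxx.
Qed.

Lemma cvec_mul v M : rotation M -> cvec (v *m M) = cvec v * cvec (row 0 M).
Proof.
move=> [m1 m2]; apply/eqP; rewrite eq_complex /= !mulmx2E !mxE m1 m2.
by apply/andP; split; apply/eqP; ring.
Qed.

Lemma cvec_inj : injective cvec.
Proof.
move=> u v [e0 e1]; apply/rowP => -[[|[|//]] lti].
  by rewrite (_ : Ordinal lti = 0) //; apply: val_inj.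
by rewrite (_ : Ordinal lti = 1) //; apply: val_inj.
Qed.

Lemma cvecD u v : cvec (u + v) = cvec u + cvec v.
Proof. by rewrite /cvec !mxE. Qed.

(** A direct isometry acts on C by [z |-> z * lin g + trans g]. *)
Definition lin (g : eucl_group) : R[i] := cvec (row 0 (val g).1).
Definition trans (g : eucl_group) : R[i] := cvec (val g).2.
Definition direct (g : eucl_group) := rotation (val g).1.

Implicit Types x y a b : eucl_group.

Lemma direct1 : direct (gone eucl_group).
Proof. exact: rotation1. Qed.

Lemma directM x y : direct x -> direct y -> direct (x ** y).
Proof. exact: rotationM. Qed.

Lemma directV x : direct x -> direct x^!.
Proof. exact: rotationV. Qed.

Lemma lin1 : lin (gone eucl_group) = 1.
Proof. by rewrite /lin /cvec !mxE. Qed.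

Lemma trans1 : trans (gone eucl_group) = 0.
Proof. by rewrite /trans /cvec !mxE. Qed.

Lemma linM x y : direct y -> lin (x ** y) = lin x * lin y.
Proof. by move=> dy; rewrite /lin /= row_mul cvec_mul. Qed.

Lemma transM x y : direct y -> trans (x ** y) = trans x * lin y + trans y.
Proof. by move=> dy; rewrite /trans /= cvecD cvec_mul. Qed.

Lemma linV x : direct x -> lin x^! = (lin x)^-1.
Proof.
move=> dx; have e : lin x^! * lin x = 1 by rewrite -linM // gmulVg lin1.
have nz : lin x != 0.
  by apply: contraTneq (oner_neq0 R[i]) => z; rewrite -e z mulr0 eqxx.
by apply: (mulIf nz); rewrite e mulVf.
Qed.

Lemma lin_neq0 x : direct x -> lin x != 0.
Proof.
move=> dx; apply: contraTneq (oner_neq0 R[i]) => z.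
by rewrite -lin1 -(gmulVg x) linM // z mulr0 eqxx.
Qed.

Lemma transV x : direct x -> trans x^! = - trans x / lin x.
Proof.
move=> dx; apply: (mulIf (lin_neq0 dx)); rewrite divfK ?lin_neq0 //.
by apply/eqP; rewrite -subr_eq0 opprK -transM // gmulVg trans1.
Qed.

Lemma eucl_ext x y : direct x -> direct y -> lin x = lin y -> trans x = trans y ->
  x = y.
Proof.
move=> [x1 x2] [y1 y2] /cvec_inj l /cvec_inj t; apply: val_inj.
rewrite [LHS]surjective_pairing [RHS]surjective_pairing t; congr pair.
have l0 j : (val x).1 0 j = (val y).1 0 j by move/rowP/(_ j): l; rewrite !mxE.
apply/matrixP => -[[|[|//]] lti] j; first by rewrite (_ : Ordinal lti = 0) //; apply: val_inj.
rewrite (_ : Ordinal lti = 1); last exact: val_inj.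
case: j => -[|[|//]] ltj.
  by rewrite (_ : Ordinal ltj = 0) ?x2 ?y2 ?l0 //; apply: val_inj.
by rewrite (_ : Ordinal ltj = 1) ?x1 ?y1 ?l0 //; apply: val_inj.
Qed.

(** * Commutators of two rotations *)

Section DirectPair.
Variables a b : eucl_group.
Hypotheses (da : direct a) (db : direct b).

Lemma direct_pow x n : direct x -> direct (gpow x n).
Proof.
move=> dx; apply: (@gpow_ind eucl_group x (fun=> direct)) => [|_ y dy|_ y dy].
- exact: direct1.
- exact: directM.
- exact/directM/directV.
Qed.

Lemma lin_pow x n : direct x -> lin (gpow x n) = lin x ^ n.
Proof.
move=> dx; apply: (@gpow_ind eucl_group x (fun n y => lin y = lin x ^ n)).
- by rewrite lin1 expr0z.
- by move=> {}n y e; rewrite linM // e expfzDr ?lin_neq0 // expr1z.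
by move=> {}n y e; rewrite linM ?linV ?e ?expfzDr ?lin_neq0 ?exprN1 //; apply: directV.
Qed.

Lemma direct_gnm n m : direct (gnm a b n m).
Proof. by apply: directM; apply: direct_pow. Qed.

Lemma lin_gnm n m : lin (gnm a b n m) = lin a ^ n * lin b ^ m.
Proof. by rewrite linM ?lin_pow //; apply: direct_pow. Qed.

Local Notation w := (a ** b^! ** a^! ** b).

Lemma direct_w : direct w.
Proof. by do !apply: directM => //; apply: directV. Qed.

Lemma lin_w : lin w = 1.
Proof.
have [daV dbV] := (directV da, directV db).
rewrite !linM // !linV //; field.
by rewrite !lin_neq0.
Qed.

Lemma direct_wconj n m : direct (wconj a b n m).
Proof.
apply: directM; last exact: direct_gnm.
by apply: directM; [apply/directV/direct_gnm | apply: direct_w].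
Qed.

Lemma lin_wconj n m : lin (wconj a b n m) = 1.
Proof.
have dg := direct_gnm n m; have gV := directV dg.
by rewrite (linM _ dg) (linM _ direct_w) (linV dg) lin_w mulr1 mulVf ?lin_neq0.
Qed.

(** As [w] is a translation, conjugation only multiplies its vector by the multiplier of
    [gnm n m]. *)
Lemma trans_wconj n m : trans (wconj a b n m) = trans w * (lin a ^ n * lin b ^ m).
Proof.
have dg := direct_gnm n m; have gV := directV dg; have dw := direct_w.
rewrite (transM _ dg) (transM _ dw) (transV dg) lin_w mulr1 -lin_gnm; field.
exact: lin_neq0.
Qed.

Lemma wconj_comm n m : gcomm w (wconj a b n m).
Proof.
have [dW dw] := (direct_wconj n m, direct_w).
apply: eucl_ext; try exact: directM.
  by rewrite (linM _ dW) (linM _ dw) lin_w lin_wconj.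
by rewrite (transM _ dW) (transM _ dw) lin_w lin_wconj !mulr1 addrC.
Qed.

Lemma direct_wprod s : direct (wprod a b s).
Proof.
elim: s => [|k s IH]; first exact: direct1.
by apply: directM => //; apply: direct_wconj.
Qed.

Lemma lin_wprod s : lin (wprod a b s) = 1.
Proof.
elim: s => [|k s IH] /=; first exact: lin1.
by rewrite linM ?IH ?lin_wconj ?mulr1 //; apply: direct_wprod.
Qed.

Lemma trans_wprod s :
  trans (wprod a b s) = trans w * \sum_(k <- s) lin a ^ k.1 * lin b ^ k.2.
Proof.
elim: s => [|k s IH] /=; first by rewrite big_nil mulr0 trans1.
rewrite big_cons transM ?lin_wprod ?trans_wconj ?IH ?mulr1 ?mulrDr //.
exact: direct_wprod.
Qed.

(** With the centres [A] and [B] as data, the vector of [w] factors, so its nonvanishing can be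
    checked factor by factor. *)
Lemma trans_w_fixed (A B : R[i]) : A * lin a + trans a = A -> B * lin b + trans b = B ->
  trans w = (A - B) * (1 - lin b) * ((lin a)^-1 - 1).
Proof.
move=> eA eB; have [daV dbV] := (directV da, directV db).
have -> : trans w = trans a * ((lin b)^-1 * (lin a)^-1 * lin b - (lin a)^-1 * lin b)
    + trans b * (1 - (lin a)^-1).
  rewrite !transM // !transV // !linV //; field.
  by rewrite !lin_neq0.
have -> : trans a = A - A * lin a by rewrite -{1}eA addrAC subrr add0r.
have -> : trans b = B - B * lin b by rewrite -{1}eB addrAC subrr add0r.
by field; rewrite !lin_neq0.
Qed.

End DirectPair.
End Isometries.

(** * The triangle *)

Section Reflections.
Variable R : realType.
Implicit Types u v P Q : point R.

Lemma dotE u v : dot u v = u 0 0 * v 0 0 + u 0 1 * v 0 1.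
Proof.
by rewrite /dot mxE !big_ord_recl big_ord0 addr0 (_ : lift ord0 ord0 = 1) ?mxE //; apply: val_inj.
Qed.

Definition cross u v : R := u 0 0 * v 0 1 - u 0 1 * v 0 0.
Definition refl_mx v : 'M[R]_2 := (2 / dot v v) *: (v^T *m v) - 1%:M.

Lemma refl_mxE v i j : refl_mx v i j = 2 / dot v v * (v 0 i * v 0 j) - (i == j)%:R.
Proof. by rewrite !mxE big_ord_recl big_ord0 addr0 !mxE. Qed.

Lemma reflection_refl_mx v : dot v v != 0 -> reflection (refl_mx v).
Proof.
move=> nz; split; rewrite !refl_mxE /=; last by rewrite [v 0 1 * _]mulrC.
by apply/eqP; rewrite -subr_eq0; apply/eqP; move: nz; rewrite dotE => nz; field.
Qed.

Lemma refl_mx_tr v : (refl_mx v)^T = refl_mx v.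
Proof. by apply/matrixP => i j; rewrite mxE !refl_mxE eq_sym [v 0 j * _]mulrC. Qed.

Lemma mul_refl_mx v : dot v v != 0 -> v *m refl_mx v = v.
Proof.
move=> nz; rewrite /refl_mx mulmxBr mulmx1 -scalemxAr mulmxA.
have -> : v *m v^T = (dot v v)%:M by rewrite [LHS]mx11_scalar.
rewrite mul_scalar_mx scalerA divfK // -[2]/(1 + 1) scalerDl scale1r.
by rewrite addrK.
Qed.

Lemma refl_mx_sq v : dot v v != 0 -> refl_mx v *m refl_mx v = 1%:M.
Proof.
move=> nz; rewrite {1}/refl_mx mulmxBl mul1mx -scalemxAl -mulmxA mul_refl_mx //.
by rewrite /refl_mx opprB addrC subrK.
Qed.

Lemma refl_line_orthogonal P Q : dot (Q - P) (Q - P) != 0 ->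
  orthogonal_isom (refl_line P Q).
Proof. by move=> nz; apply/eqP; rewrite refl_mx_tr; apply: refl_mx_sq. Qed.

Lemma refl_line_invol P Q : dot (Q - P) (Q - P) != 0 ->
  isom_mul (refl_line P Q) (refl_line P Q) = isom_one R.
Proof.
move=> nz; rewrite /isom_mul /= -/(refl_mx _) refl_mx_sq // mulmxBl -mulmxA.
by rewrite refl_mx_sq // mulmx1 addrA subrK subrr.
Qed.

Lemma refl_line_fixl P Q : isom_act (refl_line P Q) P = P.
Proof. by rewrite /isom_act /= addrC subrK. Qed.

Lemma refl_line_fixr P Q : dot (Q - P) (Q - P) != 0 ->
  isom_act (refl_line P Q) Q = Q.
Proof.
move=> nz; rewrite /isom_act /= -/(refl_mx _) addrCA -mulmxBl mul_refl_mx //.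
by rewrite addrC subrK.
Qed.

(** In C, [dot u v +i* cross u v] is the conjugate of [u] times [v]; two reflections compose to the
    rotation by twice the angle from [u] to [v]. *)
Lemma cvec_refl_mul u v : dot u u != 0 -> dot v v != 0 ->
  (dot u v +i* cross u v) ^+ 2 =
  cvec (row 0 (refl_mx u *m refl_mx v)) * (dot u u * dot v v)%:C.
Proof.
rewrite !dotE => nu nv; rewrite expr2; apply/eqP.
rewrite eq_complex /cross /= [row _ _ _ _]mxE [row _ _ _ _]mxE.
rewrite !mulmx2E !refl_mxE !dotE /=.
by apply/andP; split; apply/eqP; field; apply/andP.
Qed.

End Reflections.

(** * The reflections in the edges *)

Section Triangle.
Variables (R : realType) (A : 'I_3 -> point R).
Hypothesis A_nondeg : tri_nondegenerate A.
Hypothesis A_edges : forall i, 0 < edge_len A i.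

(** The edges are oriented cyclically and sum to zero, which fixes the signs in the law of
    cosines. *)
Definition side i : point R := A (ordS (ordS i)) - A (ordS i).

Lemma edge_len_sq i : edge_len A i ^+ 2 = dot (side i) (side i).
Proof.
rewrite sqr_sqrtr; first by rewrite !dotE !mxE; ring.
by rewrite dotE -!expr2 addr_ge0 ?sqr_ge0.
Qed.

Lemma side_neq0 i : dot (side i) (side i) != 0.
Proof. by rewrite -edge_len_sq expf_neq0 // lt0r_neq0. Qed.

Definition edge_eucl i : eucl_group R :=
  exist (fun g => is_true (orthogonal_isom g)) (edge_refl A i)
    (refl_line_orthogonal (side_neq0 i)).

Lemma edge_eucl_invol i : edge_eucl i ** edge_eucl i = gone (eucl_group R).
Proof. exact/val_inj/refl_line_invol/side_neq0. Qed.

Lemma edge_reflection i : reflection (val (edge_eucl i)).1.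
Proof. exact/reflection_refl_mx/side_neq0. Qed.

Lemma direct_edge_mul i j : direct (edge_eucl i ** edge_eucl j).
Proof. by apply: reflection_mul; apply: edge_reflection. Qed.

Lemma eval_word_parity u : let M := (val (eval_word edge_eucl u)).1 in
  if odd (size u) then reflection M else rotation M.
Proof.
elim: u => [|[i e] u /=]; first exact: rotation1.
have -> : eval_letter edge_eucl (i, e) = edge_eucl i.
  by case: e => //; apply: (invol_inv edge_eucl_invol).
case: (odd (size u)) => /= IH.
  exact: reflection_mul (edge_reflection i) IH.
exact: reflection_mulr (edge_reflection i) IH.
Qed.

Local Notation a := (edge_eucl x1 ** edge_eucl x2).
Local Notation b := (edge_eucl x1 ** edge_eucl x3).

Lemma ordS_x1 : ordS x1 = x2. Proof. exact: val_inj. Qed.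
Lemma ordS_x2 : ordS x2 = x3. Proof. exact: val_inj. Qed.
Lemma ordS_x3 : ordS x3 = x1. Proof. exact: val_inj. Qed.

(** A common point of two edges is the centre of the product of their reflections: [A x3] for [a],
    [A x2] for [b]. *)
Lemma fixed_cvec i j P : isom_act (edge_refl A i) P = P ->
  isom_act (edge_refl A j) P = P ->
  cvec P * lin (edge_eucl i ** edge_eucl j) + trans (edge_eucl i ** edge_eucl j) = cvec P.
Proof.
move=> fi fj; rewrite -cvec_mul; last exact: direct_edge_mul.
rewrite -cvecD; congr cvec; rewrite /= mulmxA -[RHS]fj -[in RHS]fi.
by rewrite /isom_act /= mulmxDl addrA.
Qed.

Lemma edge_refl_fixl i : isom_act (edge_refl A i) (A (ordS i)) = A (ordS i).
Proof. exact: refl_line_fixl. Qed.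

Lemma edge_refl_fixr i :
  isom_act (edge_refl A i) (A (ordS (ordS i))) = A (ordS (ordS i)).
Proof. exact/refl_line_fixr/side_neq0. Qed.

Lemma a_fixed : cvec (A x3) * lin a + trans a = cvec (A x3).
Proof.
apply: fixed_cvec.
  by have := edge_refl_fixr x1; rewrite ordS_x1 ordS_x2.
by have := edge_refl_fixl x2; rewrite ordS_x2.
Qed.

Lemma b_fixed : cvec (A x2) * lin b + trans b = cvec (A x2).
Proof.
apply: fixed_cvec.
  by have := edge_refl_fixl x1; rewrite ordS_x1.
by have := edge_refl_fixr x3; rewrite ordS_x3 ordS_x1.
Qed.

Lemma sides_sum : side x3 = - side x1 - side x2.
Proof.
by rewrite /side !(ordS_x1, ordS_x2, ordS_x3) !opprB addrA subrK.
Qed.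

Lemma cross_sides : cross (side x1) (side x2) != 0.
Proof.
move: A_nondeg; rewrite /tri_nondegenerate /=; apply: contraNneq => e.
apply/eqP; rewrite -e /cross /side !(ordS_x1, ordS_x2, ordS_x3) !mxE; ring.
Qed.

Section Generic.
Variable k : R.
Hypothesis k_gt0 : 0 < k.
Hypothesis indep : alg_indep (fun i => k * edge_len A i).

Let L i := k * edge_len A i.
Let sigma := 2 * k ^+ 2 * cross (side x1) (side x2).

Lemma cossideE i j l : side l = - side i - side j ->
  cosside i j l L = 2 * k ^+ 2 * dot (side i) (side j).
Proof.
move=> e; rewrite /cosside /L !exprMn !edge_len_sq e !dotE !mxE; ring.
Qed.

Lemma sqprodE i j :
  sqprod i j L = (2 * k ^+ 2) ^+ 2 * (dot (side i) (side i) * dot (side j) (side j)).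
Proof. by rewrite /sqprod /L !exprMn !edge_len_sq; ring. Qed.

Lemma lin_edge_mul i j :
  ((2 * k ^+ 2 * dot (side i) (side j)) +i* (2 * k ^+ 2 * cross (side i) (side j))) ^+ 2
  = lin (edge_eucl i ** edge_eucl j) * (sqprod i j L)%:C.
Proof.
have -> : (2 * k ^+ 2 * dot (side i) (side j)) +i* (2 * k ^+ 2 * cross (side i) (side j))
   = (2 * k ^+ 2)%:C * (dot (side i) (side j) +i* cross (side i) (side j)).
  by apply/eqP; rewrite eq_complex /= !mul0r subr0 addr0 !eqxx.
rewrite exprMn (cvec_refl_mul (side_neq0 i) (side_neq0 j)) sqprodE !rmorphM.
by rewrite mulrCA -expr2.
Qed.

Lemma edge_rotation_equations :
  [/\ sigma != 0, sigma ^+ 2 = sqprod x1 x2 L - cosside x1 x2 x3 L ^+ 2,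
      (cosside x1 x2 x3 L +i* sigma) ^+ 2 = lin a * (sqprod x1 x2 L)%:C &
      (cosside x1 x3 x2 L -i* sigma) ^+ 2 = lin b * (sqprod x1 x3 L)%:C].
Proof.
have e3 := sides_sum; have e2 : side x2 = - side x1 - side x3.
  by rewrite e3 (opprD (- side x1)) !opprK addKr.
split.
- by rewrite mulf_neq0 ?cross_sides // mulf_neq0 ?pnatr_eq0 // expf_neq0 ?lt0r_neq0.
- rewrite (cossideE e3) sqprodE /sigma !dotE /cross; ring.
- by rewrite (cossideE e3) lin_edge_mul.
(* The sign of [sigma] changes because [side x3] is [- side x1 - side x2], so its cross product with
   [side x1] is opposite. *)
rewrite (cossideE e2) -lin_edge_mul; congr ((_ +i* _) ^+ 2).
rewrite /sigma e3 /cross !mxE; ring.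
Qed.

Lemma edge_rotation_sums (s t : seq (int * int)) :
  \sum_(c <- s) lin a ^ c.1 * lin b ^ c.2 = \sum_(c <- t) lin a ^ c.1 * lin b ^ c.2 ->
  perm_eq s t.
Proof. by have [s0 sE aE bE] := edge_rotation_equations; apply: (generic_sums_int indep s0 sE aE bE). Qed.

Lemma edge_rotation_indep n m : lin a ^ n * lin b ^ m = 1 -> n = 0 /\ m = 0.
Proof. by have [s0 sE aE bE] := edge_rotation_equations; apply: (generic_mul_indep indep s0 sE aE bE). Qed.

(** The centres [A x3] and [A x2] are distinct ends of an edge, and neither multiplier is [1]. *)
Lemma trans_w_neq0 : trans (a ** b^! ** a^! ** b) != 0.
Proof.
have [s0 sE aE bE] := edge_rotation_equations.
have [a1 b1] := generic_neq1 indep s0 sE aE bE.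
have [da db] := (direct_edge_mul x1 x2, direct_edge_mul x1 x3).
rewrite (trans_w_fixed da db a_fixed b_fixed); apply: mulf_neq0; first apply: mulf_neq0.
- rewrite subr_eq0; apply: contraNneq (side_neq0 x1) => /cvec_inj e.
  by rewrite /side ordS_x1 ordS_x2 e subrr dotE !mxE !mulr0 addr0.
- by rewrite subr_eq0 eq_sym.
by rewrite subr_eq0; apply: contra_neq a1 => e; rewrite -[lin a]invrK e invr1.
Qed.

End Generic.
End Triangle.

(* G_tau = <r_1, r_2, r_3> is the image of eval_isom (edge_refl A).  The
   presentation statement: the map x_i |-> r_i from the free group induces an
   isomorphism F/N -> G_tau, N = normal closure of the relators; i.e. a word
   is trivial in G_tau iff it is trivial in every group in which all relators
   are trivial. *)
Theorem theorem4p2 (R : realType) (A : 'I_3 -> point R) :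
  tri_nondegenerate A ->
  (forall i, 0 < edge_len A i) ->
  generic A ->
  forall u : word,
    eval_isom (edge_refl A) u = isom_one R <->
    (forall (H : group) (h : 'I_3 -> H),
       (forall r, is_relator r -> eval_word h r = gone H) ->
       eval_word h u = gone H).
Proof.
move=> nondeg edges [k [k_gt0 indep]] u; pose r := edge_eucl edges.
have r_invol := edge_eucl_invol edges.
have [da db] := (direct_edge_mul edges x1 x2, direct_edge_mul edges x1 x3).
have r_comm n m := wconj_comm da db n m.
split=> [u1 H h /relator_evalP [h_invol h_comm]|]; last first.
  (* The plane isometries themselves satisfy the relators, since conjugates of [w] are
     translations. *)
  move/(_ (eucl_group R) r) => H.
  have /(congr1 val) : eval_word r u = gone (eucl_group R).
    apply/H/relator_evalP; split=> // n m _.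
    by rewrite eval_w_conj // eval_w_word.
  by rewrite eval_word_eucl.
have r1 : eval_word r u = gone (eucl_group R).
  by apply: val_inj; rewrite eval_word_eucl.
(* A word of odd length is orientation reversing, hence not the identity. *)
have even_u : odd (size u) = false.
  have := eval_word_parity edges u; rewrite -/r r1 /=.
  by case: odd => // /reflection1.
pose hr i : prod_group H (eucl_group R) := (h i, r i).
have hr_invol i : hr i ** hr i = gone (prod_group H (eucl_group R)).
  exact: (f_equal2 pair (h_invol i) (r_invol i)).
pose aH := h x1 ** h x2; pose bH := h x1 ** h x3.
(* The relators leave out [(0, 0)], where the conjugate is [w] itself. *)
have H_comm n m : gcomm (aH ** bH^! ** aH^! ** bH) (wconj aH bH n m).
  have [/eqP|nz] := eqVneq (n, m) (0, 0).
    by move=> /eqP[-> ->]; rewrite wconj00.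
  rewrite -eval_w_word // -eval_w_conj //; apply: h_comm; exact/eqP.
pose K := prod_group H (eucl_group R).
have K_comm n m : gcomm (hr x1 ** hr x2 ** (hr x1 ** hr x3)^! ** (hr x1 ** hr x2)^!
    ** (hr x1 ** hr x3)) (wconj (hr x1 ** hr x2) (hr x1 ** hr x3) n m).
  rewrite /gcomm wconj_prod; exact: (f_equal2 pair (H_comm n m) (r_comm n m)).
have := eval_word_wnf hr_invol u; rewrite even_u => -[n [m [c Cc ec]]].
have [s [t est]] := wclosure_fraction K_comm Cc.
have {ec est} : eval_word hr u ** wprod (hr x1 ** hr x2) (hr x1 ** hr x3) t =
    gnm (hr x1 ** hr x2) (hr x1 ** hr x3) n m **
    wprod (hr x1 ** hr x2) (hr x1 ** hr x3) s.
  by rewrite ec -est !gE.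
rewrite eval_word_prod !wprod_prod gnm_prod => eK.
have eH : eval_word h u ** wprod aH bH t = gnm aH bH n m ** wprod aH bH s.
  exact (congr1 (fun z : K => z.1) eK).
have eR : eval_word r u ** wprod (r x1 ** r x2) (r x1 ** r x3) t =
    gnm (r x1 ** r x2) (r x1 ** r x3) n m ** wprod (r x1 ** r x2) (r x1 ** r x3) s.
  exact (congr1 (fun z : K => z.2) eK).
rewrite r1 gmul1g in eR.
have sums := @edge_rotation_sums R A nondeg edges k k_gt0 indep.
(* Linear parts are compared: the products of conjugates are translations, so only
   [lin a ^ n * lin b ^ m = 1] remains. *)
have [n0 m0] : n = 0 /\ m = 0.
  apply: (@edge_rotation_indep R A nondeg edges k k_gt0 indep).
  rewrite -lin_gnm //; move: (congr1 (@lin R) eR).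
  rewrite (linM _ (direct_wprod da db s)) !(lin_wprod da db) mulr1; exact: esym.
rewrite n0 m0 !gnm00 !gmul1g in eH eR.
(* Translation parts are compared next, after cancelling the nonzero vector of [w]. *)
have pst : perm_eq t s.
  apply: sums; apply: (mulfI (@trans_w_neq0 R A nondeg edges k k_gt0 indep)).
  by rewrite -!trans_wprod // eR.
(* Back in [H], permuted lists give equal products, which cancel. *)
apply: (@gmulIr _ (wprod aH bH t)); rewrite gmul1g [RHS](wprod_perm H_comm pst).
exact: eH.
Qed.
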